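(* Let $\mathcal{R}$ be a commutative ring, $d\ge1$ an integer, $(a_1,\ldots,a_d)\in\mathcal{R}^d$, and $\mathbf{M}$ an $\mathcal{R}$-module. Then there are isomorphisms of $\mathcal{R}$-modules $$\mathcal{F}_{\mathbf{M}}(a_{1},\ldots,a_{d})\cong \mathbf{M}^{d}\cong\mathcal{F}(a_{1},\ldots,a_{d})\otimes_{\mathcal{R}}\mathbf{M}.$$
   Context: For $\mathbf{a}=(a_1,\ldots,a_d)\in\mathcal{R}^d$, the Fibonacci module $\mathcal{F}_{\mathbf{M}}(\mathbf{a})$ is the $\mathcal{R}$-module (under termwise operations) of sequences $(x_n)_{n\ge0}$ in $\mathbf{M}$ with $x_{n+d}=a_1x_{n+d-1}+\cdots+a_dx_n$ for all $n\ge0$. When $\mathbf{M}=\mathcal{R}$ one writes $\mathcal{F}(\mathbf{a})$. *)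

(* Defs.v *)
From HB Require Import structures.
From mathcomp Require Import all_boot all_order all_algebra.
From mathcomp Require Import boolp functions.

Set Implicit Arguments.
Unset Strict Implicit.
Unset Printing Implicit Defensive.

Import GRing.Theory.
Local Open Scope ring_scope.
Local Open Scope quotient_scope.

Definition lmod_isomorphic (R : pzRingType) (U V : lmodType R) : Prop :=
  exists f : {linear U -> V}, bijective f.

Section Fibonacci.
Variables (R : comPzRingType) (d : nat) (a : d.-tuple R) (M : lmodType R).

(* With the usual 1-based a_1, ..., a_d, the coefficient a_(i+1) is [tnth a i];
   it multiplies the term of index n + d - (i + 1), where the subtraction on
   nat does not truncate since i < d. *)
Definition fibonacci_rec (x : nat -> M) : Prop :=
  forall n : nat, x (n + d)%N = \sum_(i < d) tnth a i *: x (n + d - i.+1)%N.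

Definition fibonacci_pred : {pred (nat -> M)} := fun x => `[< fibonacci_rec x >].

Record fibonacci_module := FibonacciModule {
  fibonacci_seq :> nat -> M;
  _ : fibonacci_seq \in fibonacci_pred
}.

HB.instance Definition _ := [isSub for fibonacci_seq].
HB.instance Definition _ := [Choice of fibonacci_module by <:].

Fact fibonacci_submod_closed : submod_closed fibonacci_pred.
Proof.
split; first by apply/asboolP => n; rewrite big1 // => i _; rewrite scaler0.
move=> k x y /asboolP hx /asboolP hy; apply/asboolP => n.
have E m : (k *: x + y) m = k *: x m + y m by [].
rewrite E hx hy scaler_sumr -big_split /=.
by apply: eq_bigr => i _; rewrite E scalerDr !scalerA mulrC.
Qed.

HB.instance Definition _ :=
  GRing.isSubmodClosed.Build R (nat -> M) fibonacci_pred
    (GRing.submod_closed_semi fibonacci_submod_closed).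
HB.instance Definition _ :=
  [SubChoice_isSubLmodule of fibonacci_module by <:].

End Fibonacci.

Section Tensor.
Variables (R : comPzRingType) (U V : lmodType R).

(* The list [:: (u_1, v_1); ...; (u_k, v_k)] stands for the formal sum of the
   symbols u_i (x) v_i. [tensor_eq] is the least congruence of the monoid of
   lists that makes its quotient commutative and (u, v) |-> u (x) v bilinear;
   opposites exist in the quotient because (-u) (x) v is opposite to u (x) v,
   and scalars act through the first component. *)
Inductive tensor_eq : seq (U * V) -> seq (U * V) -> Prop :=
| tensor_eq_refl s : tensor_eq s s
| tensor_eq_sym s t : tensor_eq s t -> tensor_eq t s
| tensor_eq_trans s t w : tensor_eq s t -> tensor_eq t w -> tensor_eq s w
| tensor_eq_cat s s' t t' :
    tensor_eq s s' -> tensor_eq t t' -> tensor_eq (s ++ t) (s' ++ t')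
| tensor_eq_catC s t : tensor_eq (s ++ t) (t ++ s)
| tensor_eq_addl u u' v : tensor_eq [:: (u + u', v)] [:: (u, v); (u', v)]
| tensor_eq_addr u v v' : tensor_eq [:: (u, v + v')] [:: (u, v); (u, v')]
| tensor_eq_scale k u v : tensor_eq [:: (k *: u, v)] [:: (u, k *: v)]
| tensor_eq_zero v : tensor_eq [:: (0, v)] [::].

Definition tensor_rel : rel (seq (U * V)) := fun s t => `[< tensor_eq s t >].

Fact tensor_rel_equiv : equiv_class_of tensor_rel.
Proof.
split=> [s|s t|s t w]; first exact/asboolP/tensor_eq_refl.
  by apply/asboolP/asboolP; exact: tensor_eq_sym.
by move=> /asboolP h1 /asboolP h2; apply/asboolP; exact: tensor_eq_trans h1 h2.
Qed.
Canonical tensor_equiv := EquivRelPack tensor_rel_equiv.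

Definition tensor := {eq_quot tensor_equiv}.
HB.instance Definition _ := Choice.on tensor.
HB.instance Definition _ := EqQuotient.on tensor.

Definition tensor_class (s : seq (U * V)) : tensor := \pi_tensor s.

Lemma tensor_classW (P : tensor -> Prop) :
  (forall s, P (tensor_class s)) -> forall x, P x.
Proof. by move=> h x; rewrite -[x]reprK; exact: h. Qed.

Lemma tensor_piP s t : tensor_eq s t <-> tensor_class s = tensor_class t.
Proof. by split=> [h|/eqmodP/asboolP//]; apply/eqmodP/asboolP. Qed.

Lemma tensor_reprP s : tensor_eq (repr (tensor_class s)) s.
Proof. by apply/tensor_piP; exact: reprK. Qed.

Definition scale_formal (k : R) (s : seq (U * V)) := [seq (k *: p.1, p.2) | p <- s].

Lemma scale_formal_eq k s t :
  tensor_eq s t -> tensor_eq (scale_formal k s) (scale_formal k t).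
Proof.
elim=> {s t} /=.
- by move=> s; exact: tensor_eq_refl.
- by move=> s t _; exact: tensor_eq_sym.
- by move=> s t w _ h _; exact: tensor_eq_trans.
- by move=> s s' t t' _ h _ h'; rewrite /scale_formal !map_cat; exact: tensor_eq_cat.
- by move=> s t; rewrite /scale_formal !map_cat; exact: tensor_eq_catC.
- by move=> u u' v; rewrite scalerDr; exact: tensor_eq_addl.
- by move=> u v v'; exact: tensor_eq_addr.
- by move=> l u v; rewrite scalerA mulrC -scalerA; exact: tensor_eq_scale.
- by move=> v; rewrite scaler0; exact: tensor_eq_zero.
Qed.

Definition tensor_zero : tensor := tensor_class [::].
Definition tensor_add (x y : tensor) : tensor := tensor_class (repr x ++ repr y).
Definition tensor_scale (k : R) (x : tensor) : tensor :=
  tensor_class (scale_formal k (repr x)).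
Definition tensor_opp (x : tensor) : tensor := tensor_scale (- 1) x.

Lemma tensor_addE s t :
  tensor_add (tensor_class s) (tensor_class t) = tensor_class (s ++ t).
Proof. by apply/tensor_piP/tensor_eq_cat; exact: tensor_reprP. Qed.

Lemma tensor_scaleE k s :
  tensor_scale k (tensor_class s) = tensor_class (scale_formal k s).
Proof. by apply/tensor_piP/scale_formal_eq/tensor_reprP. Qed.

Fact tensor_addA : associative tensor_add.
Proof.
move=> x y z; elim/tensor_classW: x => s; elim/tensor_classW: y => t; elim/tensor_classW: z => w.
by rewrite (tensor_addE t w) (tensor_addE s t) !(tensor_addE _ w) (tensor_addE s) catA.
Qed.

Fact tensor_addC : commutative tensor_add.
Proof.
move=> x y; elim/tensor_classW: x => s; elim/tensor_classW: y => t; rewrite !tensor_addE.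
exact/tensor_piP/tensor_eq_catC.
Qed.

Fact tensor_add0 : left_id tensor_zero tensor_add.
Proof. by move=> x; elim/tensor_classW: x => s; rewrite tensor_addE. Qed.

Fact tensor_scaleDl (x : tensor) :
  {morph tensor_scale^~ x : k l / k + l >-> tensor_add k l}.
Proof.
elim/tensor_classW: x => s k l; rewrite !tensor_scaleE tensor_addE.
apply/tensor_piP; elim: s => [|[u v] s IH] /=; first exact: tensor_eq_refl.
rewrite scalerDl.
apply: tensor_eq_trans (tensor_eq_cat (tensor_eq_addl _ _ _) IH) _ => /=.
rewrite -cat1s; apply: (@tensor_eq_cat [:: _] [:: _]); first exact: tensor_eq_refl.
rewrite -cat1s catA -[in X in tensor_eq _ X]cat1s catA.
by apply: tensor_eq_cat; [exact: tensor_eq_catC | exact: tensor_eq_refl].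
Qed.

Fact tensor_addN : left_inverse tensor_zero tensor_opp tensor_add.
Proof.
move=> x; elim/tensor_classW: x => s; rewrite /tensor_opp.
have {2}-> : tensor_class s = tensor_scale 1 (tensor_class s).
  rewrite tensor_scaleE; congr tensor_class; rewrite /scale_formal.
  by elim: s => //= -[u v] s <- /=; rewrite scale1r.
rewrite -tensor_scaleDl addNr tensor_scaleE; apply/tensor_piP.
elim: s => [|[u v] s IH] /=; first exact: tensor_eq_refl.
by rewrite scale0r; apply: (@tensor_eq_cat [:: _] [::]) IH; exact: tensor_eq_zero.
Qed.

HB.instance Definition _ := GRing.isZmodule.Build tensor
  tensor_addA tensor_addC tensor_add0 tensor_addN.

Fact tensor_scaleA k l (x : tensor) :
  tensor_scale k (tensor_scale l x) = tensor_scale (k * l) x.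
Proof.
elim/tensor_classW: x => s; rewrite !tensor_scaleE; congr tensor_class.
by rewrite /scale_formal -map_comp; apply: eq_map => -[u v] /=; rewrite scalerA.
Qed.

Fact tensor_scale1 : left_id 1 tensor_scale.
Proof.
move=> x; elim/tensor_classW: x => s; rewrite tensor_scaleE; congr tensor_class; rewrite /scale_formal.
by elim: s => //= -[u v] s -> /=; rewrite scale1r.
Qed.

Fact tensor_scaleDr : right_distributive tensor_scale tensor_add.
Proof.
move=> k x y; elim/tensor_classW: x => s; elim/tensor_classW: y => t.
by rewrite (tensor_addE s t) !tensor_scaleE tensor_addE /scale_formal map_cat.
Qed.

HB.instance Definition _ := GRing.Zmodule_isLmodule.Build R tensor
  tensor_scaleA tensor_scale1 tensor_scaleDr tensor_scaleDl.

Lemma tensor_classD s t :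
  tensor_class (s ++ t) = tensor_class s + tensor_class t.
Proof. exact/esym/tensor_addE. Qed.

Lemma tensor_classZ k s :
  tensor_class (scale_formal k s) = k *: tensor_class s.
Proof. exact/esym/tensor_scaleE. Qed.

Definition pure_tensor (u : U) (v : V) : tensor := tensor_class [:: (u, v)].

Definition bilinear_map (P : lmodType R) (f : U -> V -> P) : Prop :=
  (forall v, linear (f^~ v)) /\ (forall u, linear (f u)).

Lemma pure_tensor_bilinear : bilinear_map pure_tensor.
Proof.
split=> [v k u u'|u k v v'] /=; rewrite /pure_tensor -tensor_classZ -tensor_classD.
  exact/tensor_piP/tensor_eq_addl.
apply/tensor_piP; apply: tensor_eq_trans (tensor_eq_addr _ _ _) _.
apply: (@tensor_eq_cat [:: _] [:: _]); last exact: tensor_eq_refl.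
exact/tensor_eq_sym/tensor_eq_scale.
Qed.

Lemma tensor_sumE s : tensor_class s = \sum_(p <- s) pure_tensor p.1 p.2.
Proof.
elim: s => [|[u v] s IH]; first by rewrite big_nil.
by rewrite big_cons -IH -tensor_classD.
Qed.

(* The universal property of the tensor product. *)
Lemma tensor_universal (P : lmodType R) (f : U -> V -> P) :
  bilinear_map f ->
  exists2 g : {linear tensor -> P},
    (forall u v, g (pure_tensor u v) = f u v) &
    (forall h : {linear tensor -> P},
      (forall u v, h (pure_tensor u v) = f u v) -> h =1 g).
Proof.
case=> fl fr.
pose F s := \sum_(p <- s) f p.1 p.2.
have f0 v : f 0 v = 0.
  by have /= := fl v (- 1) 0 0; rewrite scaler0 addr0 scaleN1r addNr.
have fS k u v : f (k *: u) v = k *: f u v.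
  by have /= := fl v k u 0; rewrite addr0 f0 addr0.
have f0r u : f u 0 = 0.
  by have /= := fr u (- 1) 0 0; rewrite scaler0 addr0 scaleN1r addNr.
have fSr k u v : f u (k *: v) = k *: f u v.
  by have /= := fr u k v 0; rewrite addr0 f0r addr0.
have FE s t : tensor_eq s t -> F s = F t.
  rewrite /F; elim=> {s t} //=.
  - by move=> s t w _ -> _ ->.
  - by move=> s s' t t' _ h _ h'; rewrite !big_cat /= h h'.
  - by move=> s t; rewrite !big_cat /= addrC.
  - move=> u u' v; rewrite !big_cons !big_nil !addr0.
    by have /= := fl v 1 u u'; rewrite !scale1r.
  - move=> u v v'; rewrite !big_cons !big_nil !addr0.
    by have /= := fr u 1 v v'; rewrite !scale1r.
  - by move=> k u v; rewrite !big_cons !big_nil !addr0 /= fS fSr.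
  - by move=> v; rewrite big_cons big_nil /= f0 addr0.
pose g (x : tensor) := F (repr x).
have gE s : g (tensor_class s) = F s by apply/FE/tensor_reprP.
have glin : linear g.
  move=> k; elim/tensor_classW=> s; elim/tensor_classW=> t.
  rewrite -tensor_classZ -tensor_classD !gE /F big_cat /=.
  rewrite scaler_sumr /scale_formal big_map; congr (_ + _).
  by apply: eq_bigr => p _; rewrite fS.
pose gL := GRing.isLinear.Build R tensor P *:%R g glin.
pose G : {linear tensor -> P} := HB.pack g gL.
exists G => [u v|h hE]; first by rewrite /= gE /F big_cons big_nil addr0.
elim/tensor_classW=> s; rewrite /= gE tensor_sumE raddf_sum.
by apply: eq_bigr => p _; exact: hE.
Qed.

End Tensor.

(* Main.v *)
Require Import Defs.
From HB Require Import structures.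
From mathcomp Require Import all_boot all_order all_algebra.
From mathcomp Require Import boolp functions.

(** A recurrent sequence is determined by its first [d] terms, which may be
    prescribed arbitrarily: the shift acts on windows of [d] consecutive terms
    by a companion map, and iterating that map on the initial window produces
    the sequence. So taking initial terms is a linear isomorphism onto [M^d].
    For [M = R] this makes [F(a)] free of rank [d], and a free module with basis
    [e_i] satisfies [M^d = U (x) M] through [m |-> \sum_i e_i (x) m_i], with
    inverse induced by [(u, v) |-> (u_i v)_i]. *)

Import GRing.Theory.
Local Open Scope ring_scope.

Section InitialTerms.
Context {R : comPzRingType} {d : nat} {a : d.-tuple R} {M : lmodType R}.

Lemma fibonacciP (x : fibonacci_module a M) : fibonacci_rec a x.
Proof. by apply/asboolP; exact: (valP x). Qed.

Definition initial_terms (x : fibonacci_module a M) : {ffun 'I_d -> M} :=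
  [ffun i : 'I_d => x i].

Lemma initial_terms_is_linear : linear initial_terms.
Proof. by move=> k x y; apply/ffunP => i; rewrite !ffunE. Qed.

HB.instance Definition _ := GRing.isLinear.Build R (fibonacci_module a M)
  {ffun 'I_d -> M} *:%R initial_terms initial_terms_is_linear.

Lemma initial_terms_inj : injective initial_terms.
Proof.
move=> x y /ffunP xy; apply/val_inj/funext => n /=.
elim/ltn_ind: n => n IH; have [lt_nd|le_dn] := ltnP n d.
  by have := xy (Ordinal lt_nd); rewrite !ffunE.
rewrite -(subnK le_dn) !fibonacciP; apply: eq_bigr => i _.
by rewrite subnK // IH // ltn_subrL /=; apply: leq_trans le_dn; apply: leq_ltn_trans (ltn_ord i).
Qed.

(* A window of [d] consecutive terms is a function on [nat] of which only the
   values below [d] matter. *)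
Definition shift_window (s : nat -> M) (i : nat) : M :=
  if (i.+1 < d)%N then s i.+1 else \sum_(j < d) tnth a j *: s (d - j.+1)%N.

(** A shift moves entry [i.+1] to entry [i], so each step back along the window can be traded for
    one more shift. *)
Lemma iter_shift_window s n i : (i < d)%N ->
  iter n shift_window s i = iter (n + i) shift_window s 0%N.
Proof.
elim: i n => [|i IH] n lt_id; first by rewrite addn0.
by rewrite addnS -addSn -(IH _ (ltnW lt_id)) /= {2}/shift_window lt_id.
Qed.

Lemma iter_shift_window_rec s : (0 < d)%N ->
  fibonacci_rec a (fun n => iter n shift_window s 0%N).
Proof.
(* Read [n + d] as [n.+1 + d.-1]: the last entry after [n.+1] shifts, where [shift_window] takes its
   [else] branch. *)
move=> d_gt0 n; rewrite -{1}(prednK d_gt0) addnS -addSn.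
rewrite -iter_shift_window ?prednK // /= {1}/shift_window prednK // ltnn.
apply: eq_bigr => i _; rewrite -addnBA // -iter_shift_window //.
by rewrite ltn_subrL d_gt0.
Qed.

Lemma initial_terms_surj (f : {ffun 'I_d -> M}) : (0 < d)%N ->
  exists x, initial_terms x = f.
Proof.
(* The padding by 0 sits at indices from [d] on, which [shift_window] never reads. *)
move=> d_gt0; pose s n := if insub n is Some i then f i else 0.
have /asboolP xP := iter_shift_window_rec s d_gt0.
exists (FibonacciModule xP); apply/ffunP => i; rewrite ffunE /=.
by rewrite -[i : nat]add0n -iter_shift_window //= /s valK.
Qed.

Lemma initial_terms_bij : (0 < d)%N -> bijective initial_terms.
Proof.
move=> d_gt0; have /choice [g gK] := fun f => initial_terms_surj f d_gt0.
by exists g => // x; apply: initial_terms_inj.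
Qed.

End InitialTerms.

Lemma tensor_free_isomorphic (R : comPzRingType) (I : finType)
    (U M : lmodType R) :
  lmod_isomorphic U {ffun I -> R^o} -> lmod_isomorphic {ffun I -> M} (tensor U M).
Proof.
case=> f f_bij; have [g fK gK] := f_bij.
(* The basis of [U] that [f] carries to the standard basis. *)
pose e i := g [ffun j => (j == i)%:R].
have e_coord i j : f (e i) j = (j == i)%:R by rewrite gK ffunE.
have e_span u : u = \sum_i f u i *: e i.
  apply: (bij_inj f_bij); apply/ffunP => j; rewrite linear_sum sum_ffunE.
  rewrite (bigD1 j) //= linearZ ffunE e_coord eqxx big1 => [|i /negPf ij].
    by rewrite addr0 /GRing.scale /= mulr1.
  by rewrite linearZ ffunE e_coord eq_sym ij scaler0.
have [tl tr] := pure_tensor_bilinear U M.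
pose coord_scale u v : {ffun I -> M} := [ffun i => (f u i : R) *: v].
have coord_scale_bilinear : bilinear_map coord_scale.
  split=> [v k u u'|u k v v']; apply/ffunP => i; rewrite !ffunE.
    by rewrite linearP !ffunE scalerDl scalerA.
  by rewrite scalerDr !scalerA mulrC.
have [psi psiE _] := tensor_universal coord_scale_bilinear.
pose phi (m : {ffun I -> M}) := \sum_i pure_tensor (e i) (m i).
have phi_linear : linear phi.
  move=> k m m'; rewrite /phi scaler_sumr -big_split /=.
  by apply: eq_bigr => i _; rewrite !ffunE tr.
pose Phi : {linear {ffun I -> M} -> tensor U M} :=
  HB.pack phi (GRing.isLinear.Build _ _ _ _ phi phi_linear).
exists Phi; exists psi => [m|t].
  apply/ffunP => j; rewrite /= linear_sum sum_ffunE (bigD1 j) //=.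
  rewrite psiE ffunE e_coord eqxx scale1r big1 ?addr0 // => i /negPf ij.
  by rewrite psiE ffunE e_coord eq_sym ij scale0r.
elim/tensor_classW: t => s; rewrite tensor_sumE !linear_sum.
apply: eq_bigr => -[u v] _ /=; rewrite psiE /phi.
(* With the first slot packed as a linear map, expanding [u] gives [\sum_i (u_i e_i) (x) v], and
   each scalar then crosses to [v]. *)
pose tensor_v : {linear U -> tensor U M} :=
  HB.pack (@pure_tensor R U M ^~ v) (GRing.isLinear.Build _ _ _ _ _ (tl v)).
rewrite [in RHS](e_span u) -[RHS]/(tensor_v _) linear_sum; apply: eq_bigr => i _.
by rewrite ffunE; exact/tensor_piP/tensor_eq_sym/tensor_eq_scale.
Qed.

Theorem proposition3p3 (R : comPzRingType) (d : nat) (d_ge1 : (1 <= d)%N)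
    (a : d.-tuple R) (M : lmodType R) :
  lmod_isomorphic (fibonacci_module a M) {ffun 'I_d -> M} /\
  lmod_isomorphic {ffun 'I_d -> M} (tensor (fibonacci_module a R^o) M).
Proof.
(* Used at [M] for the first isomorphism and at [R^o] for the second. *)
have iso N : lmod_isomorphic (fibonacci_module a N) {ffun 'I_d -> N}.
  by exists initial_terms; exact: initial_terms_bij.
by split; [exact: iso | exact/tensor_free_isomorphic/iso].
Qed.
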